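(* Let $A$ be a positive information algebra, let $L$ be a well-ordered set disjoint from $A$, and let $S=A\uplus_{\mathrm{ord}}L$ be the overflow semiring. Then $S$ is Artinian if and only if (1) $A$ is Artinian and (2) $L$ is finite.
   Context: All semirings are commutative: $(S,+,0)$ and $(S,\cdot,1)$ are commutative monoids, $1\neq 0$, multiplication distributes over addition, and $0$ is absorbing. A semiring is zerosumfree if $a+b=0$ implies $a=b=0$, and entire if $ab=0$ implies $a=0$ or $b=0$; an information algebra is a zerosumfree entire semiring. A positive information algebra is an information algebra with a partial order $\leq$ compatible with $+$ and $\cdot$ (i.e. $x\leq y$ implies $x+z\leq y+z$ and $xz\leq yz$) and having $0$ as least element. An ideal of a semiring $S$ is a nonempty subset $I$ with $a+b\in I$ and $sa\in I$ for all $a,b\in I$, $s\in S$. A semiring is Artinian if it satisfies the descending chain condition on ideals. Overflow semiring $S=A\uplus_{\mathrm{ord}}L$: for a positive information algebra $A$ and a join-semilattice $L$ disjoint from $A$, $S=A\cup L$ with the order extending those of $A$ and $L$ by $a\leq\ell$ for all $a\in A,\ell\in L$ (and never $\ell\leq a$), and operations: $x+y=x+_Ay$ if $x,y\in A$, $x+y=\sup\{x,y\}$ otherwise; $xy=x\cdot_Ay$ if $x,y\in A\setminus\{0\}$, $xy=0$ if $x=0$ or $y=0$, and $xy=\sup\{x,y\}$ otherwise. With these, $S$ is a positive information algebra. *)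

(* Defs.v *)
From HB Require Import structures.
From mathcomp Require Import all_boot all_order all_algebra.
From mathcomp Require Import boolp classical_sets cardinality wochoice.

Set Implicit Arguments.
Unset Strict Implicit.
Unset Printing Implicit Defensive.

Import Order.TTheory GRing.Theory.
Local Open Scope classical_set_scope.
Local Open Scope ring_scope.

HB.mixin Record isInfoAlgebra A of GRing.ComNzSemiRing A := {
  addr_zerosumfree : forall a b : A, a + b = 0 -> a = 0 /\ b = 0 ;
  mulr_entire : forall a b : A, a * b = 0 -> a = 0 \/ b = 0
}.

#[short(type="infoAlgebraType")]
HB.structure Definition InfoAlgebra :=
  {A of isInfoAlgebra A & GRing.ComNzSemiRing A}.

(* The order is a relation of its own rather than a porderType instance on A:
   a structure joining POrder (of any display) with a semiring cannot be
   declared next to POrderedZmodule, which fixes ring_display. *)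
HB.mixin Record isPosInfoAlgebra A of InfoAlgebra A := {
  info_le : rel A ;
  info_le_refl : reflexive info_le ;
  info_le_anti : antisymmetric info_le ;
  info_le_trans : transitive info_le ;
  info_le_add : forall x y z : A, info_le x y -> info_le (x + z) (y + z) ;
  info_le_mul : forall x y z : A, info_le x y -> info_le (x * z) (y * z) ;
  info_le0 : forall x : A, info_le 0 x
}.

#[short(type="posInfoAlgebraType")]
HB.structure Definition PosInfoAlgebra :=
  {A of isPosInfoAlgebra A & InfoAlgebra A}.

(* Unlike the ideals of ring_quotient, these are not required to be proper. *)
Definition is_ideal (S : comNzSemiRingType) (I : set S) : Prop :=
  [/\ I !=set0,
      forall a b, I a -> I b -> I (a + b) &
      forall s a, I a -> I (s * a)].

Definition artinian (S : comNzSemiRingType) : Prop :=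
  forall I : nat -> set S,
    (forall n, is_ideal (I n)) ->
    (forall n, I n.+1 `<=` I n) ->
    exists N, forall n, (N <= n)%N -> I n = I N.

(* The disjoint union is the sum type: inl embeds A and inr embeds L. *)
Definition overflow (d : Order.disp_t) (A : posInfoAlgebraType)
  (L : joinSemilatticeType d) : Type := (A + L)%type.

Section Overflow.
Variables (d : Order.disp_t) (A : posInfoAlgebraType).
Variable L : joinSemilatticeType d.
Local Notation S := (overflow A L).

HB.instance Definition _ := Choice.copy S (A + L)%type.

Definition overflow_le (x y : S) : bool :=
  match x, y with
  | inl a, inl b => info_le a b
  | inl _, inr _ => true
  | inr _, inl _ => false
  | inr l, inr m => (l <= m)%O
  end.

Fact overflow_le_refl : reflexive overflow_le.
Proof. by case=> x /=; [exact: info_le_refl | exact: lexx]. Qed.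

Fact overflow_le_anti : antisymmetric overflow_le.
Proof. by case=> x [] y //=; [move/info_le_anti-> | move/le_anti->]. Qed.

Fact overflow_le_trans : transitive overflow_le.
Proof.
by case=> y [] x [] z //=; [exact: info_le_trans | exact: le_trans].
Qed.

Definition overflow_zero : S := inl 0.
Definition overflow_one : S := inl 1.

(* The sup in S of l in L and of an element of A is l; see overflow_add_sup
   and overflow_mul_sup below. *)
Definition overflow_add (x y : S) : S :=
  match x, y with
  | inl a, inl b => inl (a + b)
  | inl _, inr l | inr l, inl _ => inr l
  | inr l, inr m => inr (Order.join l m)
  end.

Definition overflow_mul (x y : S) : S :=
  match x, y with
  | inl a, inl b => inl (a * b)
  | inl a, inr l | inr l, inl a => if a == 0 then inl 0 else inr l
  | inr l, inr m => inr (Order.join l m)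
  end.

Fact overflow_addA : associative overflow_add.
Proof. by case=> x [] y [] z //=; rewrite ?addrA ?joinA. Qed.

Fact overflow_addC : commutative overflow_add.
Proof. by case=> x [] y //=; rewrite 1?addrC 1?joinC. Qed.

Fact overflow_add0 : left_id overflow_zero overflow_add.
Proof. by case=> x //=; rewrite add0r. Qed.

HB.instance Definition _ := GRing.isNmodule.Build S
  overflow_addA overflow_addC overflow_add0.

Lemma mulr_eq0P (a b : A) : (a * b == 0) = (a == 0) || (b == 0).
Proof.
apply/eqP/orP => [/mulr_entire[]->|[]/eqP->]; rewrite ?eqxx ?mul0r ?mulr0 //.
  by left.
by right.
Qed.

Lemma addr_eq0P (a b : A) : (a + b == 0) = (a == 0) && (b == 0).
Proof.
by apply/eqP/andP => [/addr_zerosumfree[-> ->]|[/eqP-> /eqP->]]; rewrite ?addr0.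
Qed.

Fact overflow_mulA : associative overflow_mul.
Proof.
case=> x [] y [] z /=; rewrite ?mulrA ?joinA ?mulr_eq0P //.
- have [?|/negbTE x0] := eqVneq x 0; have [?|y0] := eqVneq y 0; subst=> //=;
    by rewrite ?mulr0 ?mul0r ?eqxx ?x0.
- have [?|/negbTE x0] := eqVneq x 0; have [?|/negbTE z0] := eqVneq z 0;
    by subst=> //=; rewrite ?mulr0 ?mul0r ?eqxx ?x0 ?z0.
- by have [x0|x0] := eqVneq x 0; rewrite /= ?eqxx.
- have [?|y0] := eqVneq y 0; have [?|/negbTE z0] := eqVneq z 0; subst=> //=;
    by rewrite ?mulr0 ?mul0r ?eqxx ?z0.
- by have [y0|y0] := eqVneq y 0; rewrite /= ?eqxx.
- by have [z0|z0] := eqVneq z 0; rewrite /= ?eqxx.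
Qed.

Fact overflow_mulC : commutative overflow_mul.
Proof. by case=> x [] y //=; rewrite 1?mulrC 1?joinC. Qed.

Fact overflow_mul1 : left_id overflow_one overflow_mul.
Proof. by case=> x //=; rewrite ?mul1r ?oner_eq0. Qed.

Fact overflow_mulDl : left_distributive overflow_mul overflow_add.
Proof.
case=> x [] y [] z /=; rewrite ?mulrDl ?addr_eq0P //.
- have [?|x0] := eqVneq x 0; have [?|y0] := eqVneq y 0; subst=> //=;
    by rewrite ?addr0 ?joinxx.
- by have [->|z0 //] := eqVneq z 0; rewrite /= mulr0 addr0.
- by have [//|x0 /=] := eqVneq x 0; rewrite joinCA joinxx joinC.
- by have [->|z0 //] := eqVneq z 0; rewrite /= mulr0 addr0.
- by have [//|y0 /=] := eqVneq y 0; rewrite -joinA joinxx.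
- by have [_|z0 //] := eqVneq z 0; rewrite /= addr0.
- by rewrite joinACA joinxx.
Qed.

Fact overflow_mul0 : left_zero overflow_zero overflow_mul.
Proof. by case=> x //=; rewrite ?mul0r ?eqxx. Qed.

Fact overflow_one_neq0 : overflow_one != overflow_zero.
Proof. by apply/eqP => -[] /eqP; rewrite oner_eq0. Qed.

HB.instance Definition _ := GRing.Nmodule_isComNzSemiRing.Build S
  overflow_mulA overflow_mulC overflow_mul1 overflow_mulDl overflow_mul0
  overflow_one_neq0.

Fact overflow_zerosumfree (x y : S) : x + y = 0 -> x = 0 /\ y = 0.
Proof. by case: x y => x [] y // [] /addr_zerosumfree[-> ->]. Qed.

Fact overflow_entire (x y : S) : x * y = 0 -> x = 0 \/ y = 0.
Proof.
rewrite -[x * y]/(overflow_mul x y) -[0]/overflow_zero.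
case: x y => x [] y //=.
- by case=> /mulr_entire[]->; [left | right].
- by case: eqP => [->|//]; left.
- by case: eqP => [->|//]; right.
Qed.

HB.instance Definition _ := isInfoAlgebra.Build S
  overflow_zerosumfree overflow_entire.

Lemma info_le_eq0 (a : A) : info_le a 0 -> a = 0.
Proof. by move=> a0; apply: info_le_anti; rewrite a0 info_le0. Qed.

Fact overflow_le_add (x y z : S) :
  overflow_le x y -> overflow_le (x + z) (y + z).
Proof.
case: x y z => x [] y [] z //=; rewrite ?leUr //.
- exact: info_le_add.
- by move=> xy; exact: leU2.
Qed.

Fact overflow_le_mul (x y z : S) :
  overflow_le x y -> overflow_le (x * z) (y * z).
Proof.
case: x y z => x [] y [] z; rewrite /GRing.mul //=.
- exact: info_le_mul.
- have [->|x0] := eqVneq x 0; first by case: ifP; rewrite /= ?info_le0.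
  by case: eqP => [-> /info_le_eq0 /eqP|//=]; rewrite ?(negbTE x0).
- by case: eqP => [->|//]; rewrite mulr0 info_le_refl.
- by case: eqP => _ _ /=; rewrite ?info_le0 ?leUr.
- by case: eqP => [_|//]; rewrite /= info_le_refl.
- by move=> xy; exact: leU2.
Qed.

Fact overflow_le0 (x : S) : overflow_le 0 x.
Proof. by case: x => x //=; exact: info_le0. Qed.

HB.instance Definition _ := isPosInfoAlgebra.Build S
  overflow_le_refl overflow_le_anti overflow_le_trans
  overflow_le_add overflow_le_mul overflow_le0.

Definition is_sup (x y s : S) : Prop :=
  [/\ info_le x s, info_le y s &
      forall t : S, info_le x t -> info_le y t -> info_le s t].

Definition in_A (x : S) : bool := if x is inl _ then true else false.

Lemma overflow_add_sup (x y : S) : ~~ (in_A x && in_A y) -> is_sup x y (x + y).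
Proof.
case: x y => x [] y // _; split=> //=;
  rewrite /info_le /= ?leUl ?leUr //; case=> //= t xt yt.
by rewrite leUx xt yt.
Qed.

Lemma overflow_mul_sup (x y : S) : ~~ (in_A x && in_A y) ->
  x != 0 -> y != 0 -> is_sup x y (x * y).
Proof.
have inl0 (a : A) : (inl a != 0 :> S) = (a != 0).
  by [].
move=> xy x0 y0; suff -> : x * y = x + y by exact: overflow_add_sup.
case: x y xy x0 y0 => x [] y // _; rewrite ?inl0 => x0 y0;
  by rewrite /GRing.mul /= ?(negbTE x0) ?(negbTE y0).
Qed.

End Overflow.

(* Main.v *)
Require Import Defs.
From HB Require Import structures.
From mathcomp Require Import all_boot all_order all_algebra.
From mathcomp Require Import boolp classical_sets cardinality wochoice.

(* An ideal of S that contains a nonzero element of A contains all of L, and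
   [inl a * inr l = inr l] for nonzero a, so up to 0 the ideals of S are the
   up-sets of L and the sets I + L with I a nonzero ideal of A. Hence S is
   Artinian iff A is and descending chains of up-sets of L stabilise; in a
   well-order the latter forces L to be finite. *)

Import Order.TTheory GRing.Theory.
Local Open Scope classical_set_scope.

Lemma descending_chain_le {T : Type} {I : nat -> set T} :
  (forall n, I n.+1 `<=` I n) ->
  forall m n, (m <= n)%N -> I n `<=` I m.
Proof.
move=> dI m n /subnK <-; elim: (n - m)%N => [|k IHk] //.
by rewrite addSn; exact: subset_trans (dI _) IHk.
Qed.

(** Each point either drops out of the chain at some stage or stays forever; with finitely many
    points, one stage bounds all the departures. *)
Lemma descending_chain_finite {T : choiceType} {I : nat -> set T} :
  finite_set [set: T] -> (forall n, I n.+1 `<=` I n) ->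
  exists N, forall n, (N <= n)%N -> I n = I N.
Proof.
move=> /finite_seqP[s sT] dI; have leI := descending_chain_le dI.
have [N NP] : exists N, forall x, x \in s ->
    forall n, (N <= n)%N -> I N x -> I n x.
  elim: s {sT} => [|y s [N NP]]; first by exists 0.
  have [[M nIM]|/forallNP Iy] := pselect (exists M, ~ I M y).
    (* Once [y] has left at stage [M], the condition on [y] holds vacuously. *)
    exists (maxn M N) => x; rewrite inE => /orP[/eqP->|xs] n leMNn IMN.
      by case: nIM; exact: (leI _ _ (leq_maxl M N)).
    apply: (NP x xs n (leq_trans (leq_maxr M N) leMNn)).
    exact: (leI _ _ (leq_maxr M N)).
  exists N => x; rewrite inE => /orP[/eqP-> n _ _|]; last exact: NP.
  exact: contrapT (Iy n).
exists N => n leNn; apply/seteqP; split; first exact: leI.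
by move=> x; apply: NP => //; have : [set` s] x by rewrite -sT.
Qed.

Lemma ideal0 {S : comNzSemiRingType} {I : set S} : is_ideal I -> I 0%R.
Proof. by move=> [[x Ix] _ /(_ 0%R x Ix)]; rewrite mul0r. Qed.

Section OverflowIdeals.
Context {d : Order.disp_t} {A : posInfoAlgebraType}.
Context {L : joinSemilatticeType d}.
Local Notation S := (overflow A L).

Lemma overflow_ideal_preimage {I : set S} :
  is_ideal I -> is_ideal [set a : A | I (inl a)].
Proof.
move=> idI; have [_ addI mulI] := idI; split.
- by exists 0%R; exact: ideal0 idI.
- by move=> a b Ia Ib; exact: addI Ia Ib.
- by move=> s a Ia; exact: mulI (inl s) _ Ia.
Qed.

(** A product of an element of [L] with one of [I] is [0] or lies in [L], so adjoining all of [L]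
    keeps closure and leaves the trace on [A] equal to [I]. *)
Lemma overflow_ideal_saturate {I : set A} : is_ideal I ->
  is_ideal [set x : S | if x is inl a then I a else True].
Proof.
move=> idI; have [_ addI mulI] := idI; split.
- by exists (inl 0%R); exact: ideal0 idI.
- by move=> [a|l] [b|m] //; exact: addI.
- move=> [s|l] [a|m] // Ia; first exact: mulI.
  + by rewrite /GRing.mul /=; case: eqP => // _; exact: ideal0 idI.
  + by rewrite /GRing.mul /=; case: eqP => // _; exact: ideal0 idI.
Qed.

(** Adding to or multiplying an element of [L] only moves it up, except that a factor [0] gives [0],
    which is therefore adjoined to [U]. *)
Lemma overflow_ideal_up {U : set L} : (forall l m, U l -> (l <= m)%O -> U m) ->
  is_ideal [set x : S | match x with inl a => a = 0%R | inr l => U l end].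
Proof.
move=> upU; split.
- by exists (inl 0%R).
- move=> [a|l] [b|m] //=; rewrite /GRing.add /=.
  + by move=> -> ->; exact: addr0.
  + by move=> Ul _; apply: upU Ul _; exact: leUl.
- move=> [s|l] [a|m] //=; rewrite /GRing.mul /=.
  + by move=> ->; exact: mulr0.
  + by case: eqP.
  + by move=> ->; rewrite eqxx.
  + by move=> Um; apply: upU Um _; exact: leUr.
Qed.

(** An ideal of [S] is determined by its traces on [A] and [L], and both chains of traces
    stabilise. *)
Lemma artinian_overflow :
  artinian A -> finite_set [set: L] -> artinian S.
Proof.
move=> artA finL I idI dI.
have [N NP] := artA _ (fun n => overflow_ideal_preimage (idI n))
  (fun n a => dI n (inl a)).
have [M MP] := descending_chain_finite finL (fun n l => dI n (inr l)).
have constI n : (maxn N M <= n)%N -> forall x, I n x = I (maxn N M) x.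
  rewrite geq_max => /andP[leNn leMn] [a|l].
    (* Stages [n] and [maxn N M] are both compared with stage [N], and with stage [M] on [L]. *)
    by have := congr1 (@^~ a) (NP _ leNn);
      have := congr1 (@^~ a) (NP _ (leq_maxl N M)) => /= -> ->.
  by have := congr1 (@^~ l) (MP _ leMn);
    have := congr1 (@^~ l) (MP _ (leq_maxr N M)) => /= -> ->.
by exists (maxn N M) => n /constI /funext.
Qed.

Lemma artinian_overflow_base : artinian S -> artinian A.
Proof.
move=> artS I idI dI.
have [//|N NP] := artS _ (fun n => overflow_ideal_saturate (idI n)).
  by move=> n [a|l] //; exact: dI.
exists N => n /NP eqI; apply/funext => a.
exact: (congr1 (@^~ (inl a : S)) eqI).
Qed.

Lemma artinian_overflow_up {U : nat -> set L} : artinian S ->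
  (forall n l m, U n l -> (l <= m)%O -> U n m) ->
  (forall n, U n.+1 `<=` U n) ->
  exists N, forall n, (N <= n)%N -> U n = U N.
Proof.
move=> artS upU dU.
have [//|N NP] := artS _ (fun n => overflow_ideal_up (upU n)).
  by move=> n [a|l] //; exact: dU.
exists N => n /NP eqU; apply/funext => l.
exact: (congr1 (@^~ (inr l : S)) eqU).
Qed.

End OverflowIdeals.

Lemma infinite_inj_seq {T : choiceType} :
  infinite_set [set: T] -> exists f : nat -> T, injective f.
Proof.
move=> infT; have [x0 _] := infinite_setN0 infT.
(* [pcard_injP] is applied with a pointed codomain; [x0] serves as the point. *)
pose Tp : pointedType := HB.pack (Choice.sort T) (isPointed.Build T x0).
have /(@pcard_injP _ Tp)[f finj] : ([set: nat] #<= [set: Tp])%card by exact/infiniteP.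
by exists f => m n; apply: finj; rewrite inE.
Qed.

(* For an injective sequence [f], the up-sets generated by the tails of [f]
   decrease; if they stabilise from [N] on, the least value [f k] of the tail
   from [N] must be attained again beyond [k]. *)
Lemma well_order_finite {d : Order.disp_t} {L : orderType d} :
  well_order (fun x y : L => (x <= y)%O) ->
  (forall U : nat -> set L,
     (forall n l m, U n l -> (l <= m)%O -> U n m) ->
     (forall n, U n.+1 `<=` U n) ->
     exists N, forall n, (N <= n)%N -> U n = U N) ->
  finite_set [set: L].
Proof.
move=> woL stabL; apply: contrapT => /infinite_inj_seq[f finj].
pose U n := [set l : L | exists2 k, (n <= k)%N & (f k <= l)%O].
have [|n l [k ltnk fkl]|N UN] := stabL U.
- by move=> n l m [k lenk fkl] llm; exists k => //; exact: le_trans llm.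
- by exists k => //; exact: ltnW.
have [|m [[]]] := woL [pred l | `[< exists2 k, (N <= k)%N & f k = l >]].
  by exists (f N); apply/asboolP; exists N.
move=> /asboolP[k leNk <-] min_fk _.
have : U N (f k) by exists k.
(* Stage [k.+1], not [k], makes [j] differ from [k], against injectivity. *)
rewrite -(UN k.+1 (leqW leNk)) => -[j ltkj fjk].
have fkj : (f k <= f j)%O.
  apply: min_fk; apply/asboolP; exists j => //.
  exact: leq_trans (ltnW ltkj).
have /finj jk : f j = f k by apply: le_anti; rewrite fjk.
by rewrite jk ltnn in ltkj.
Qed.

Theorem theorem4p20 (A : posInfoAlgebraType) (d : Order.disp_t)
  (L : orderType d) (L_wo : well_order (fun x y : L => (x <= y)%O)) :
  artinian (overflow A L) <-> artinian A /\ finite_set [set: L]%classic.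
Proof.
split=> [artS|[artA finL]]; last exact: artinian_overflow.
split; first exact: artinian_overflow_base artS.
by apply: well_order_finite L_wo _ => U; exact: artinian_overflow_up artS.
Qed.
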